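(* Let $\beta>1$ be a real number. For every $r$ with $0\leq r\leq+\infty$, $$\dim_{\mathrm{H}}\{x\in[0,1):r_\beta(x)=r\}=\frac{1}{1+r},$$ where $\frac{1}{1+r}$ is interpreted as $0$ when $r=+\infty$.
   Context: For real $\beta>1$, the $\beta$-transformation $T_\beta:[0,1)\to[0,1)$ is $T_\beta(x)=\beta x \bmod 1=\beta x-\lfloor\beta x\rfloor$, and $T_\beta^n$ denotes its $n$-th iterate. For $x\in[0,1)$ the asymptotic recurrence exponent is $$r_\beta(x):=\sup\{0\leq r\leq+\infty:\ |T_\beta^n x-x|<(\beta^n)^{-r}\ \text{for infinitely many } n\in\mathbb{N}\}\in[0,+\infty].$$ $\dim_{\mathrm{H}}$ denotes Hausdorff dimension. *)

(* Defs.v *)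
From HB Require Import structures.
From mathcomp Require Import all_boot all_order all_algebra.
From mathcomp Require Import all_classical all_reals all_analysis.

Set Implicit Arguments.
Unset Strict Implicit.
Unset Printing Implicit Defensive.

Import Order.TTheory GRing.Theory Num.Theory.
Import numFieldNormedType.Exports.

Local Open Scope classical_set_scope.
Local Open Scope ring_scope.

Section Hausdorff.
Context {R : realType}.
Local Open Scope ereal_scope.

(* [ereal_sup set0] is -oo, so the diameter of the empty set is -oo. *)
Definition diam (U : set R) : \bar R :=
  ereal_sup [set `|(z.1 - z.2)%R|%:E | z in U `*` U].

(* The empty set always weighs 0. A singleton weighs 1 when s = 0, because
   [powR 0 0 = 1], so that the 0-dimensional measure counts points. *)
Definition diam_pow (s : R) (U : set R) : \bar R :=
  if U == set0 then 0 else diam U `^ s.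

Definition hausdorff_premeasure (s delta : R) (E : set R) : \bar R :=
  ereal_inf [set \sum_(0 <= k <oo) diam_pow s (U k) |
    U in [set U : (set R)^nat |
      (forall k, diam (U k) <= delta%:E) /\ E `<=` \bigcup_k U k]].

Definition hausdorff_measure (s : R) (E : set R) : \bar R :=
  ereal_sup [set hausdorff_premeasure s delta E |
    delta in [set delta : R | (0 < delta)%R]].

Definition hausdorff_dim (E : set R) : \bar R :=
  ereal_inf [set s%:E |
    s in [set s : R | (0 <= s)%R /\ hausdorff_measure s E = 0]].

End Hausdorff.

Section BetaTransformation.
Context {R : realType}.

(* The formula on all of R; for x in [0, 1) the orbit stays in [0, 1). *)
Definition beta_map (beta x : R) : R :=
  beta * x - (Num.floor (beta * x))%:~R.

(* a ^ (-r) for a > 1 and 0 <= r <= +oo, with the limit value a ^ (-oo) = 0;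
   the value at r = -oo is irrelevant. *)
Definition powN (a : R) (r : \bar R) : R :=
  if r is r'%:E then a `^ (- r') else 0.

Definition recurrence_exponent (beta x : R) : \bar R :=
  ereal_sup [set r : \bar R | (0 <= r)%E /\
    infinite_set [set n : nat |
      `|iter n (beta_map beta) x - x| < powN (beta ^+ n) r]].

End BetaTransformation.

(* Main.v *)
Require Import Defs.
From HB Require Import structures.
From mathcomp Require Import all_boot all_order all_algebra.
From mathcomp Require Import all_classical all_reals all_analysis.
From mathcomp Require Import zify ring lra.
Import Order.TTheory GRing.Theory Num.Theory.
Import numFieldNormedType.Exports.
Local Open Scope classical_set_scope.
Local Open Scope ring_scope.

(** Why the theorem holds. Write T for the beta-transformation.

    Upper bound. On each of its branches T^n is affine of slope beta^n, so the
    solutions of |T^n x - x| < beta^(-nt) in one branch lie in an interval of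
    length of order beta^(-n(1+t)). There are O(beta^n) branches
    ([branches]), and sum_n beta^n beta^(-n(1+t)s) converges as soon as
    (1+t)s > 1. By the Borel-Cantelli argument [hcontent0_limsup] the points
    that satisfy the inequality for infinitely many n form an s-null set
    ([hcontent_recurrent]); letting t increase to r bounds the dimension of
    the level set by 1/(1+r).

    Lower bound. For finite r put p = 1+r. It is enough that the s-dimensional
    content of {exponent >= r} is nonzero at the critical s = 1/p: the set
    {exponent > r} is a countable union of sets {exponent > r + 1/m}, each
    s-null by the upper bound, so that removing it leaves the level set with
    nonzero content ([hcontent_exponent_eq]). Working at the critical s
    reduces the exact exponent to a one-sided condition.

    For r > 0 the content is bounded below on a Cantor set. Every subinterval
    of [0, 1) of length (n+1) beta^(-n) contains a full cylinder of order n
    ([exists_full_cylinder]); inside it T^n has a fixed point, and around that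
    point a window on which T^n x stays close to x
    ([exists_recurrent_window]). Hence each window of one generation can be
    cut into M equal blocks, each carrying one window of the next generation
    in its left half. If the windows of generation k have length (2Q)^(-p),
    where Q is the number of these windows, then u |-> (point of the Cantor set
    whose address is given by the mixed-radix digits of u) satisfies
    (|u - v| / 8)^p <= |g u - g v| ([cantor_content_neq0]). Covers of the Cantor
    set then pull back to covers of [0, 1), whose Lebesgue measure is 1, and
    this bounds the content from below ([hcontent_neq0_of_holder]). The
    polynomial loss in M and the choice of the lengths only cost a factor
    beta^(n eps) in the recurrence inequality, with eps as small as desired
    when n is large ([exists_scale]), so every point of the Cantor set has
    exponent at least r. For r = 0 the identity replaces g. *)

Set Implicit Arguments.
Unset Strict Implicit.
Unset Printing Implicit Defensive.

(** * Hausdorff content and Hausdorff dimension *)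

Lemma infinite_nat_unbounded (A : set nat) :
  infinite_set A <-> forall m, exists2 n, (m <= n)%N & A n.
Proof.
split=> [Ainf m|Aub].
  apply: contrapT => noA; apply: Ainf; apply: sub_finite_set (finite_II m).
  move=> n An /=; rewrite ltnNge; apply/negP => mn; apply: noA; by exists n.
move=> /finite_seqP[s As]; have [n] := Aub (\max_(i <- s) i).+1.
rewrite As /= => + ns; rewrite ltnNge => /negP; apply.
exact: leq_bigmax_seq.
Qed.

Section Content.
Context {R : realType}.
Local Open Scope ereal_scope.
Implicit Types (s t : R) (E U : set R).

(** The Hausdorff content: the premeasure with no bound on the diameters of the
    covers. It has the same null sets as the Hausdorff measure when s > 0, and
    is easier to handle. Making every set measurable turns it into an instance
    of the Caratheodory extension, hence countable subadditivity. *)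
Definition hausdorff_content s : set R -> \bar R :=
  mu_ext (diam_pow s : set (g_sigma_algebraType [set: set R]) -> \bar R).

Lemma diam_pow0 s : diam_pow s set0 = 0.
Proof. by rewrite /diam_pow eqxx. Qed.

Lemma diam_pow_ge0 s U : 0 <= diam_pow s U.
Proof. by rewrite /diam_pow; case: ifP => // _; exact: poweR_ge0. Qed.

Lemma diam_ge_dist U x y : U x -> U y -> `|x - y|%:E <= diam U.
Proof. by move=> Ux Uy; apply: ereal_sup_ubound; exists (x, y). Qed.

Lemma diam_ge0 U : U !=set0 -> 0 <= diam U.
Proof.
by case=> x Ux; apply: le_trans (diam_ge_dist Ux Ux); rewrite lee_fin.
Qed.

Lemma discrete_measurable_all (F : set (g_sigma_algebraType [set: set R])) :
  measurable F.
Proof. exact: sub_gen_smallest. Qed.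

Lemma hcontent_ge0 s E : 0 <= hausdorff_content s E.
Proof. by apply: mu_ext_ge0 => U; exact: diam_pow_ge0. Qed.

Lemma hcontent_le s E E' :
  E `<=` E' -> hausdorff_content s E <= hausdorff_content s E'.
Proof.
exact: (@le_mu_ext _ (g_sigma_algebraType [set: set R]) R (diam_pow s) E E').
Qed.

Lemma hcontent_bigcup s (F : (set R)^nat) :
  hausdorff_content s (\bigcup_n F n) <= \sum_(n <oo) hausdorff_content s (F n).
Proof. by apply: mu_ext_sigma_subadditive => U; exact: diam_pow_ge0. Qed.

Lemma hcontent_le_cover s E (U : (set R)^nat) : E `<=` \bigcup_k U k ->
  hausdorff_content s E <= \sum_(k <oo) diam_pow s (U k).
Proof.
move=> EU; apply: ereal_inf_lbound; exists U => //; split => // i.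
exact: discrete_measurable_all.
Qed.

Lemma hcontent_lt_cover s E (c : \bar R) : hausdorff_content s E < c ->
  exists2 U : (set R)^nat, E `<=` \bigcup_k U k &
    \sum_(k <oo) diam_pow s (U k) < c.
Proof. by move=> /ereal_inf_lt[_ [U [_ EU] <-]]; exists U. Qed.

Lemma premeasure_ge_content s delta E :
  hausdorff_content s E <= hausdorff_premeasure s delta E.
Proof.
by apply: le_ereal_inf_tmp => _ [U [_ EU] <-]; exact: hcontent_le_cover.
Qed.

Lemma hausdorff_measure_ge_content s E :
  hausdorff_content s E <= hausdorff_measure s E.
Proof.
apply: le_trans (premeasure_ge_content s 1 E) _.
by apply: ereal_sup_ubound; exists 1%R => //=; exact: ltr01.
Qed.

Lemma diam_pow_term s (U : (set R)^nat) k :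
  diam_pow s (U k) <= \sum_(i <oo) diam_pow s (U i).
Proof.
rewrite (nneseries_split 0 k.+1) ?add0n; last by move=> *; exact: diam_pow_ge0.
rewrite big_nat_recr//= -addeA [X in _ <= X]addeC -addeA leeDl// adde_ge0//.
  by apply: nneseries_ge0 => *; exact: diam_pow_ge0.
by apply: sume_ge0 => *; exact: diam_pow_ge0.
Qed.

Lemma diam_le_of_pow s (e : R) U : (0 < s)%R -> (0 < e)%R ->
  diam_pow s U <= (e `^ s)%:E -> diam U <= e%:E.
Proof.
move=> s0 e0; rewrite /diam_pow; case: ifPn => [/eqP -> _|/set0P U0].
  by apply: ge_ereal_sup => ? [z [] /=].
have := diam_ge0 U0; case: (diam U) => [d| |] //=.
  rewrite !lee_fin => d0; apply: contraTT; rewrite -!ltNge => ed.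
  by rewrite gt0_ltr_powR// ?nnegrE//; exact: ltW.
by move=> _; rewrite (gt_eqF s0) leye_eq.
Qed.

(** In a cover whose total cost is small every single diameter is small, so the
    constraint on diameters in the premeasures comes for free. *)
Lemma hausdorff_measure0 s E : (0 < s)%R ->
  hausdorff_content s E = 0 -> hausdorff_measure s E = 0.
Proof.
move=> s0 E0; apply/eqP; rewrite eq_le; apply/andP; split; last first.
  by rewrite -E0 hausdorff_measure_ge_content.
apply: ge_ereal_sup => _ [d /= d0 <-].
apply/lee_addgt0Pr => e e0; rewrite add0e.
have m0 : (0 < Num.min e (d `^ s))%R by rewrite lt_min e0 powR_gt0.
have [] := @hcontent_lt_cover s E (Num.min e (d `^ s))%:E.
  by rewrite E0 lte_fin.
move=> U EU sumU; apply: (@le_trans _ _ (\sum_(k <oo) diam_pow s (U k))).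
  apply: ereal_inf_lbound; exists U => //; split => // k.
  apply: (diam_le_of_pow s0 d0); apply: le_trans (diam_pow_term s U k) _.
  by apply: (le_trans (ltW sumU)); rewrite lee_fin ge_min lexx orbT.
by apply: (le_trans (ltW sumU)); rewrite lee_fin ge_min lexx.
Qed.

(** Cost below 1 means diameter below 1 when t > 0; when t = 0 it forces U to be
    empty, since a nonempty set costs at least 1 in dimension 0. *)
Lemma diam_pow_mono t s U : (0 <= t)%R -> (t <= s)%R ->
  diam_pow t U < 1 -> diam_pow s U <= diam_pow t U.
Proof.
move=> t0 ts; rewrite /diam_pow; case: ifPn => // /set0P U0.
have := diam_ge0 U0; case: (diam U) => [d| |] //=.
  rewrite !lee_fin lte_fin => d0; have [->|t1] := eqVneq t 0%R.
    by rewrite powRr0 ltxx.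
  have [->|dn0] := eqVneq d 0%R.
    by move=> _; rewrite !powR0// gt_eqF// (lt_le_trans _ ts)// lt_neqAle eq_sym t1.
  move=> dt1; apply: ger_powR => //; rewrite lt_neqAle eq_sym dn0 d0/=.
  rewrite leNgt; apply/negP => d1; move: dt1; rewrite ltNge => /negP; apply.
  by rewrite -(powRr0 d); apply: ler_powR => //; exact: ltW.
by move=> _; case: ifP => // _; rewrite ltxx.
Qed.

Lemma hcontent0_mono t s E : (0 <= t)%R -> (t <= s)%R ->
  hausdorff_content t E = 0 -> hausdorff_content s E = 0.
Proof.
move=> t0 ts E0; apply/eqP; rewrite eq_le hcontent_ge0 andbT.
apply/lee_addgt0Pr => e e0; rewrite add0e.
have m0 : (0 < Num.min e 1)%R by rewrite lt_min e0 ltr01.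
have [] := @hcontent_lt_cover t E (Num.min e 1)%:E.
  by rewrite E0 lte_fin.
move=> U EU sumU; apply: (le_trans (hcontent_le_cover s EU)).
apply: (@le_trans _ _ (\sum_(k <oo) diam_pow t (U k))).
  apply: lee_nneseries => [k _ _|k _]; first exact: diam_pow_ge0.
  apply: diam_pow_mono => //; apply: (le_lt_trans (diam_pow_term t U k)).
  by apply: (lt_le_trans sumU); rewrite lee_fin ge_min lexx orbT.
by apply: (le_trans (ltW sumU)); rewrite lee_fin ge_min lexx.
Qed.

Lemma hausdorff_dim_le t E : (0 <= t)%R ->
  (forall s, (t < s)%R -> hausdorff_content s E = 0) -> hausdorff_dim E <= t%:E.
Proof.
move=> t0 Et; apply/lee_addgt0Pr => e e0; apply: ereal_inf_lbound.
have te : (t < t + e)%R by rewrite ltrDl.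
exists (t + e)%R => //=; split; first exact: ltW (le_lt_trans t0 te).
by apply: hausdorff_measure0; [exact: le_lt_trans te|exact: Et].
Qed.

Lemma hausdorff_dim_ge0 E : 0 <= hausdorff_dim E.
Proof. by apply: le_ereal_inf_tmp => _ [s [s0 _] <-]; rewrite lee_fin. Qed.

(** Nonzero content at s excludes null measure at every t < s, and this is all
    that the lower bound on the dimension asks. *)
Lemma hausdorff_dim_ge s E :
  hausdorff_content s E != 0 -> s%:E <= hausdorff_dim E.
Proof.
move=> Es; apply: le_ereal_inf_tmp => _ [t [t0 Et] <-]; rewrite lee_fin leNgt.
apply/negP => ts; case/eqP: Es; apply: (hcontent0_mono t0 (ltW ts)).
apply/eqP; rewrite eq_le hcontent_ge0 andbT -Et.
exact: hausdorff_measure_ge_content.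
Qed.

Lemma hcontent0_bigcup s (F : (set R)^nat) :
  (forall n, hausdorff_content s (F n) = 0) ->
  hausdorff_content s (\bigcup_n F n) = 0.
Proof.
move=> F0; apply/eqP; rewrite eq_le hcontent_ge0 andbT.
by apply: (le_trans (hcontent_bigcup s F)); rewrite eseries0// => n _ _.
Qed.

Lemma hcontent_setU0 s E F :
  hausdorff_content s E = 0 -> hausdorff_content s F = 0 ->
  hausdorff_content s (E `|` F) = 0.
Proof.
move=> E0 F0; rewrite -bigcup2E; apply: hcontent0_bigcup => -[|[|n]] //=.
apply/eqP; rewrite eq_le hcontent_ge0 andbT -E0; apply: hcontent_le; exact: sub0set.
Qed.

Lemma hcontent_bigcup_geometric s (F : (set R)^nat) (C q : R) :
  (0 <= C)%R -> (0 <= q < 1)%R ->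
  (forall n, hausdorff_content s (F n) <= (C * q ^+ n)%:E) ->
  hausdorff_content s (\bigcup_n F n) <= (C / (1 - q))%:E.
Proof.
move=> C0 /andP[q0 q1] FC; apply: (le_trans (hcontent_bigcup s F)).
apply: lime_le; first by apply: is_cvg_nneseries => *; exact: hcontent_ge0.
apply: nearW => n; apply: (@le_trans _ _ (\sum_(0 <= i < n) (C * q ^+ i)%:E)).
  by apply: lee_sum.
rewrite sumEFin lee_fin -mulr_sumr ler_wpM2l//.
have d0 : (0 < 1 - q)%R by rewrite subr_gt0.
rewrite -(ler_pM2l d0) mulfV ?gt_eqF// big_mkord.
by rewrite -opprB mulNr -subrX1 opprB gerBl exprn_ge0.
Qed.

(** Borel-Cantelli: E is covered by each tail of the sequence F, and the tails of
    a convergent geometric series tend to 0. *)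
Lemma hcontent0_limsup s E (F : (set R)^nat) (C q : R) :
  (0 <= C)%R -> (0 <= q < 1)%R ->
  (forall n, hausdorff_content s (F n.+1) <= (C * q ^+ n.+1)%:E) ->
  (forall x, E x -> infinite_set [set n | F n x]) ->
  hausdorff_content s E = 0.
Proof.
move=> C0 /[dup] q01 /andP[q0 q1] FC EF.
have tail m : hausdorff_content s E <= (C / (1 - q) * q ^+ m.+1)%:E.
  have -> : (C / (1 - q) * q ^+ m.+1)%R = (C * q ^+ m.+1 / (1 - q))%R by ring.
  apply: (@le_trans _ _ (hausdorff_content s (\bigcup_n F (m + n).+1))).
    apply: hcontent_le => x /EF /infinite_nat_unbounded/(_ m.+1)[n mn Fn].
    by exists (n - m.+1)%N => //=; rewrite -addSn subnKC.
  apply: hcontent_bigcup_geometric => // [|n].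
    by rewrite mulr_ge0// exprn_ge0.
  by rewrite -mulrA -exprD addSn.
apply/eqP; rewrite eq_le hcontent_ge0 andbT.
have cv : geometric (C / (1 - q) * q) q @ \oo --> (0 : R)%R.
  by apply: cvg_geometric; rewrite ger0_norm.
have cvE : (geometric (C / (1 - q) * q) q n)%:E @[n --> \oo] --> (0 : R)%:E.
  by apply/fine_cvgP; split; [exact: nearW|exact: cv].
suff: hausdorff_content s E <= (0 : R)%:E by [].
rewrite -(cvg_lim _ cvE)//; apply: lime_ge; first by apply/cvg_ex; exists 0.
by apply: nearW => n; have := tail n; rewrite exprS mulrA.
Qed.

Lemma hcontent_le_balls s E (xs : seq R) (l : R) : (0 < s)%R -> (0 <= l)%R ->
  (forall x, E x -> exists2 y, y \in xs & (`|x - y| <= l)%R) ->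
  hausdorff_content s E <= ((size xs)%:R * (2 * l) `^ s)%:E.
Proof.
move=> s0 l0 Exs.
pose U k := if (k < size xs)%N then [set x | `|x - xs`_k| <= l]%R else set0.
have EU : E `<=` \bigcup_k U k.
  move=> x /Exs[y yxs xy]; exists (index y xs) => //.
  by rewrite /U index_mem yxs /= nth_index.
apply: (le_trans (hcontent_le_cover s EU)).
rewrite (nneseries_split 0 (size xs)); last by move=> *; exact: diam_pow_ge0.
rewrite add0n [X in _ + X]eseries0 ?adde0; last first.
  by move=> k /= xk _; rewrite /U ltnNge xk /= diam_pow0.
apply: (@le_trans _ _ (\sum_(0 <= k < size xs) ((2 * l) `^ s)%:E)); last first.
  by rewrite sumEFin lee_fin sumr_const_nat subn0 -[leLHS]mulr_natl.
apply: lee_sum => k _; rewrite /diam_pow; case: ifPn => [_|/set0P U0].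
  by rewrite lee_fin powR_ge0.
have dU : diam (U k) <= (2 * l)%:E.
  apply: ge_ereal_sup => z [[x y] [/=]]; rewrite /U; case: ifP => //= _.
  move=> xl yl <-; rewrite lee_fin.
  have -> : (x - y = (x - xs`_k) - (y - xs`_k))%R by ring.
  by apply: (le_trans (ler_normB _ _)); rewrite mulr2n mulrDl mul1r lerD.
have := diam_ge0 U0; move: dU; case: (diam (U k)) => [d| |] //=.
by rewrite !lee_fin => dl d0; rewrite ge0_ler_powR// ?nnegrE ?mulr_ge0//; exact: ltW.
Qed.

(** A mass distribution principle without measures. The hypothesis says that the
    inverse of g is Holder of exponent 1/p, so that the part of [0, 1) sent by g
    into a set U lies in an interval of length 2 C (diam U)^(1/p). A cover of W
    of cost below 1/(4C) would thus give a cover of [0, 1) of total length below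
    1/2. *)
Lemma hcontent_neq0_of_holder (p C : R) (W : set R) (g : R -> R) :
  (0 < p)%R -> (0 < C)%R ->
  (forall u : R, (0 <= u < 1)%R -> W (g u)) ->
  (forall u v : R, (0 <= u)%R -> (u <= v)%R -> (v < 1)%R ->
     (((v - u) / C) `^ p <= `|g v - g u|)%R) ->
  hausdorff_content p^-1 W != 0.
Proof.
move=> p0 C0 gW gC; apply/eqP => W0.
have c0 : (0 < (4 * C)^-1)%R by rewrite invr_gt0 mulr_gt0.
have [] := @hcontent_lt_cover p^-1 W ((4 * C)^-1)%:E.
  by rewrite W0 lte_fin.
move=> U WU sumU.
have gsym (u v : R) : (0 <= u < 1)%R -> (0 <= v < 1)%R ->
    (((`|v - u|) / C) `^ p <= `|g v - g u|)%R.
  move=> /andP[u0 u1] /andP[v0 v1]; have [uv|vu] := leP u v.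
    by rewrite ger0_norm ?subr_ge0//; exact: gC.
  rewrite distrC ger0_norm ?subr_ge0 ?(ltW vu)// [leRHS]distrC.
  by apply: gC => //; exact: ltW.
have Vex k : exists V : set R, [/\ measurable V,
    lebesgue_measure V <= (2 * C)%:E * diam_pow p^-1 (U k) &
    forall u : R, (0 <= u < 1)%R -> U k (g u) -> V u].
  have [[u0 [u01 Uu0]]|noU] := pselect (exists u : R, (0 <= u < 1)%R /\ U k (g u)).
    have Uk0 : U k != set0 by apply/set0P; exists (g u0).
    have := le_lt_trans (diam_pow_term p^-1 U k) sumU.
    rewrite /diam_pow (negbTE Uk0) => ltU.
    have := lty_poweRy _ (lt_trans ltU (ltry _)); rewrite invr_eq0 gt_eqF// => /(_ isT) dfin.
    have d0 := diam_ge0 (ex_intro _ _ Uu0 : U k !=set0).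
    move: ltU d0 dfin (@diam_ge_dist (U k)); case: (diam (U k)) => [d| |]//= _.
    rewrite lee_fin => d0 _ dd.
    pose l := (C * d `^ p^-1)%R.
    have l0 : (0 <= l)%R by rewrite mulr_ge0// ?powR_ge0// ltW.
    exists `[(u0 - l)%R, (u0 + l)%R]%classic; split => //.
      rewrite lebesgue_measure_itv/= lte_fin.
      case: ifP => _; last by rewrite lee_fin mulr_ge0 ?powR_ge0// mulr_ge0// ltW.
      rewrite -EFinD lee_fin /l le_eqVlt; apply/orP; left; apply/eqP.
      by ring.
    move=> u u01' Uu; rewrite /= in_itv/= -ler_distl.
    rewrite /l -ler_pdivrMl// mulrC.
    have -> : (`|u - u0| / C = ((`|u - u0| / C) `^ p) `^ p^-1)%R.
      by rewrite -powRrM mulfV ?gt_eqF// powRr1// divr_ge0// ltW.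
    rewrite ge0_ler_powR ?nnegrE ?powR_ge0 ?invr_ge0//; first exact: ltW.
    apply: (le_trans (gsym _ _ u01 u01')).
    by have := dd _ _ Uu Uu0; rewrite lee_fin.
  exists set0; split => //; first by rewrite measure0 mule_ge0 ?diam_pow_ge0// lee_fin mulr_ge0// ltW.
  by move=> u u01 Uu; apply: noU; exists u.
have [V HV] := choice Vex.
have : lebesgue_measure (`[0%R, 1%R[%classic : set R) <= \sum_(k <oo) lebesgue_measure (V k).
  apply: measure_sigma_subadditive => //.
  - by move=> k; have [] := HV k.
  - move=> u /=; rewrite in_itv/= => u01; have [k _ Uk] := WU _ (gW _ u01).
    by exists k => //; have [_ _] := HV k; apply.
rewrite lebesgue_measure_itv/= lte_fin ltr01 oppr0 adde0 leNgt => /negP; apply.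
apply: (@le_lt_trans _ _ (\sum_(k <oo) (2 * C)%:E * diam_pow p^-1 (U k))).
  by apply: lee_nneseries => k _ *; have [] := HV k.
rewrite nneseriesZl//; last by move=> *; exact: diam_pow_ge0.
apply: (@lt_trans _ _ ((2 * C)%:E * (4 * C)^-1%:E)).
  by rewrite lte_pmul2l// lte_fin mulr_gt0.
rewrite -EFinM lte_fin; have -> : (2 * C / (4 * C) = 2^-1)%R.
  by field; rewrite gt_eqF.
lra.
Qed.

End Content.

(** * Branches and full cylinders of the beta-transformation *)

Section Dynamics.
Context {R : realType}.
Variable beta : R.
Hypothesis beta1 : 1 < beta.
Local Notation T := (beta_map beta).
Implicit Types (x y z a b rho t s : R) (n d : nat).

Let beta_gt0 : 0 < beta. Proof. exact: lt_trans beta1. Qed.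
Let betaX_gt0 n : 0 < beta ^+ n. Proof. exact: exprn_gt0. Qed.

Lemma beta_mapE x d : d%:R <= beta * x < d.+1%:R -> T x = beta * x - d%:R.
Proof.
move=> dx; rewrite /beta_map (@floor_def _ _ d%:Z) ?pmulrn//.
by rewrite intrD1 -!pmulrn natr1.
Qed.

(** A pair (k, c) at level n stands for the branch of T^n on
    [k / beta^n, (k + c) / beta^n), where T^n x = beta^n x - k has range [0, c).
    All children have range [0, 1) except the rightmost one, listed first. *)
Definition branch_children (kc : R * R) : seq (R * R) :=
  let m := Num.truncn (beta * kc.2) in
  (beta * kc.1 + m%:R, beta * kc.2 - m%:R) ::
  [seq (beta * kc.1 + d%:R, 1) | d <- iota 0 m].

(** The sum of the ranges is multiplied by beta at each step because only
    cutting takes place, and a branch of range c has at most beta c + 1 children.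
    So passing from n to n+1 adds at most beta^(n+1) branches, and the count
    stays below a geometric sum: Renyi's bound. *)
Lemma branches n : exists br : seq (R * R),
  [/\ forall x, 0 <= x < 1 -> exists2 kc, kc \in br &
        kc.1 <= beta ^+ n * x < kc.1 + kc.2 /\
        iter n T x = beta ^+ n * x - kc.1,
      {in br, forall kc, 0 <= kc.2},
      \sum_(kc <- br) kc.2 = beta ^+ n &
      (size br)%:R <= beta / (beta - 1) * beta ^+ n].
Proof.
have b1 : 0 < beta - 1 by rewrite subr_gt0.
elim: n => [|n [br [br_cov br_ge0 br_sum br_size]]].
  exists [:: (0, 1)]; split=> [x x01|kc||] /=.
  - by exists (0, 1); rewrite ?mem_head //= mul1r subr0 add0r.
  - by rewrite inE => /eqP ->.
  - by rewrite big_seq1.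
  - by rewrite mulr1 ler_pdivlMr// mul1r gerBl.
exists (flatten [seq branch_children kc | kc <- br]); split.
- move=> x x01; have [[k c] kcbr /= [kx Tnx]] := br_cov x x01.
  set y := iter n T x in Tnx *.
  have y0 : 0 <= y by rewrite Tnx subr_ge0; case/andP: kx.
  have yc : y < c by rewrite Tnx ltrBlDl; case/andP: kx.
  have by0 : 0 <= beta * y by rewrite mulr_ge0// ltW.
  have bc0 : 0 <= beta * c by rewrite mulr_ge0 ?ltW// (le_lt_trans y0 yc).
  have byc : beta * y < beta * c by rewrite ltr_pM2l.
  have /andP[d1 d2] := truncn_itv by0; have /andP[m1 m2] := truncn_itv bc0.
  have Ty := beta_mapE (truncn_itv by0).
  set d := Num.truncn (beta * y) in d1 d2 Ty *.
  set m := Num.truncn (beta * c) in m1 m2.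
  have dm : (d <= m)%N.
    by rewrite -ltnS -(ltr_nat R); apply: le_lt_trans d1 (lt_trans byc m2).
  have bnx : beta ^+ n.+1 * x = beta * y + beta * k by rewrite exprS Tnx; ring.
  exists (beta * k + d%:R, if d == m then beta * c - m%:R else 1).
    apply/flatten_mapP; exists (k, c) => //; rewrite /branch_children /= -/m.
    rewrite inE; case: (eqVneq d m) => [->|dm']; first by rewrite eqxx.
    apply/orP; right.
    by apply/mapP; exists d => //; rewrite mem_iota /= ltn_neqAle dm' dm.
  rewrite /= -/y Ty bnx; split; last by ring.
  have -> /= : beta * k + d%:R <= beta * y + beta * k by rewrite addrC lerD2r.
  case: eqP => [->|_]; first by rewrite addrAC -addrA addrC -addrA; lra.
  by rewrite -natr1 in d2; lra.
- move=> kc /flatten_mapP[[k c] /br_ge0 /= c0]; rewrite inE => /orP[/eqP -> /=|].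
    have bc0 : 0 <= beta * c by rewrite mulr_ge0 ?(ltW beta_gt0).
    by rewrite subr_ge0; case/andP: (truncn_itv bc0).
  by case/mapP => d _ ->.
- rewrite big_flatten big_map /= exprS -br_sum mulr_sumr; apply: eq_bigr => kc _.
  rewrite big_cons big_map /= big_const_seq count_predT size_iota.
  by rewrite iter_addr addr0 subrK.
- have -> : (size (flatten [seq branch_children kc | kc <- br]))%:R =
      \sum_(kc <- br) ((Num.truncn (beta * kc.2))%:R + 1) :> R.
    rewrite size_flatten /shape -map_comp sumnE big_map natr_sum.
    by apply: eq_bigr => kc _; rewrite /= size_map size_iota -natr1.
  apply: (@le_trans _ _ (\sum_(kc <- br) (beta * kc.2 + 1))).
    rewrite big_seq [leRHS]big_seq; apply: ler_sum => kc /br_ge0 c0.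
    have bc0 : 0 <= beta * kc.2 by rewrite mulr_ge0 ?(ltW beta_gt0).
    by rewrite lerD2r; case/andP: (truncn_itv bc0).
  rewrite big_split /= -mulr_sumr br_sum big_const_seq count_predT iter_addr addr0.
  have -> : beta / (beta - 1) * beta ^+ n.+1 =
      beta * beta ^+ n + beta / (beta - 1) * beta ^+ n.
    by rewrite exprS; field; rewrite gt_eqF.
  by rewrite lerD2l.
Qed.

Lemma powR_exprn a n t : 0 <= a -> (a ^+ n) `^ t = (a `^ t) ^+ n.
Proof. by move=> a0; rewrite -!powR_mulrn ?powR_ge0// powRAC. Qed.

(** The inequality defining the recurrence exponent, for a finite exponent t. *)
Definition recurrent_at t n : set R :=
  [set x | 0 <= x < 1 /\ `|iter n T x - x| < (beta ^+ n) `^ (- t)].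

(** In a branch T^n x - x = (beta^n - 1) (x - k / (beta^n - 1)), so the points
    to cover form one ball around k / (beta^n - 1) for each branch. Order 0 is
    left out because there beta^n - 1 vanishes. *)
Lemma hcontent_recurrent_at t s n : 0 < s ->
  (hausdorff_content s (recurrent_at t n.+1) <=
   (beta / (beta - 1) * (2 * (beta / (beta - 1))) `^ s * (beta `^ (1 - (1 + t) * s)) ^+ n.+1)%:E)%E.
Proof.
move=> s0; set C := beta / (beta - 1); have [br [br_cov _ _ br_size]] := branches n.+1.
have b1 : 0 < beta - 1 by rewrite subr_gt0.
have C0 : 0 < C by rewrite divr_gt0.
set B := beta ^+ n.+1 in br_cov br_size.
have B0 : 0 < B by exact: betaX_gt0.
have BbB : beta <= B by rewrite /B exprS ler_peMr ?exprn_ege1// ltW.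
have BB1 : B / C <= B - 1.
  rewrite /C invf_div mulrA ler_pdivrMr//; nra.
have B1 : 0 < B - 1 by rewrite (lt_le_trans _ BB1)// divr_gt0.
pose l := C * B `^ (- (1 + t)).
have l0 : 0 <= l by rewrite mulr_ge0 ?powR_ge0// ltW.
have lE : B `^ (- t) = B / C * l.
  rewrite /l opprD powRD; last by rewrite (gt_eqF B0) implybT.
  by rewrite powR_inv1 ?ltW//; field; rewrite !gt_eqF.
apply: (@le_trans _ _ ((size br)%:R * (2 * l) `^ s)%:E%E).
  have -> : size br = size [seq kc.1 / (B - 1) | kc <- br] by rewrite size_map.
  apply: hcontent_le_balls => // x [x01 xr].
  have [kc kcbr [_ Tx]] := br_cov x x01.
  exists (kc.1 / (B - 1)); first by apply/mapP; exists kc.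
  rewrite -(ler_pM2l B1) -{1}(ger0_norm (ltW B1)) -normrM.
  have -> : (B - 1) * (x - kc.1 / (B - 1)) = iter n.+1 T x - x.
    by rewrite Tx; field; rewrite gt_eqF.
  apply: (le_trans (ltW xr)); rewrite -/B lE.
  by rewrite ler_wpM2r.
rewrite lee_fin.
have -> : C * (2 * C) `^ s * beta `^ (1 - (1 + t) * s) ^+ n.+1 =
    C * B * (2 * l) `^ s.
  rewrite -powR_exprn ?(ltW beta_gt0)// -/B /l [2 * (C * _)]mulrA.
  have C20 : 0 <= 2 * C by rewrite mulr_ge0 ?(ltW C0).
  rewrite [(2 * C * _) `^ s]powRM ?powR_ge0//.
  rewrite -powRrM mulNr powRD ?(gt_eqF B0) ?implybT// powRr1 ?(ltW B0)//.
  by ring.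
by rewrite ler_wpM2r ?powR_ge0.
Qed.

Lemma powR_lt1 t : t < 0 -> beta `^ t < 1.
Proof.
move=> t0; rewrite -(opprK t) powRN invf_lt1 ?powR_gt0//.
have := @gt0_ltr_powR _ (- t); rewrite oppr_gt0 => /(_ t0 1 beta).
by rewrite powR1 !nnegrE; apply => //; exact: ltW.
Qed.

Lemma hcontent_recurrent t s : 0 < s -> 1 < (1 + t) * s ->
  hausdorff_content s
    [set x | 0 <= x < 1 /\ infinite_set [set n | recurrent_at t n x]] = 0%E.
Proof.
move=> s0 ts; have b1 : 0 < beta - 1 by rewrite subr_gt0.
have C0 : 0 < beta / (beta - 1) by rewrite divr_gt0.
apply: (hcontent0_limsup _ _ (fun n => hcontent_recurrent_at t n s0)).
- by rewrite mulr_ge0 ?powR_ge0// ltW.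
- by rewrite powR_ge0 powR_lt1// subr_lt0.
- by move=> x [].
Qed.

(** The branch of order n starting at z has the whole of [0, 1) as range. *)
Definition full_cylinder n z :=
  forall x, z <= x < z + (beta ^+ n)^-1 -> iter n T x = beta ^+ n * (x - z).

Lemma full_cylinderS n z d : 0 <= z -> z + (beta ^+ n)^-1 <= 1 ->
  full_cylinder n z -> full_cylinder n.+1 ((d%:R + z) / beta).
Proof.
move=> z0 z1 zfull x /andP[xz xz'].
have bx1 : d%:R + z <= beta * x by rewrite mulrC -ler_pdivrMr.
have bx2 : beta * x < d%:R + z + (beta ^+ n)^-1.
  have E : beta * ((d%:R + z) / beta + (beta ^+ n.+1)^-1) =
      d%:R + z + (beta ^+ n)^-1.
    by rewrite exprS; field; rewrite ?(gt_eqF beta_gt0) ?(gt_eqF (betaX_gt0 n)).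
  by rewrite -E ltr_pM2l.
rewrite iterSr (@beta_mapE x d); last by rewrite -natr1; lra.
rewrite zfull; last by lra.
by rewrite exprS; field; rewrite gt_eqF.
Qed.

Lemma full_cylinder0 n : full_cylinder n 0.
Proof.
elim: n => [|n IH]; first by move=> x _ /=; rewrite mul1r subr0.
have -> : 0 = ((0%N)%:R + 0) / beta :> R by rewrite addr0 mul0r.
apply: full_cylinderS => //; rewrite add0r invf_le1 ?betaX_gt0//.
by rewrite exprn_ege1// ltW.
Qed.

(** Apply T and look at the image interval, which is long enough for order n plus
    one spare unit beta^(-n). If it passes an integer d by at least that unit, the
    cylinder of zeros starting at d fits in. Otherwise the part to the left
    of d (all of the image, if it contains no integer) is still long enough for
    order n, and induction applies there. *)
Lemma exists_full_cylinder n a b : 0 <= a -> b <= 1 ->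
  n.+1%:R / beta ^+ n <= b - a ->
  exists2 z, a <= z /\ z + (beta ^+ n)^-1 <= b & full_cylinder n z.
Proof.
elim: n a b => [|n IH] a b a0 b1 ab.
  rewrite expr0 divr1 in ab.
  have a00 : a = 0 by apply/eqP; rewrite eq_le a0 andbT; lra.
  exists 0; last exact: full_cylinder0.
  by rewrite a00 add0r expr0 invr1; lra.
pose e := (beta ^+ n)^-1.
have e0 : 0 < e by rewrite invr_gt0.
have ba0 : 0 <= beta * a by rewrite mulr_ge0// ltW.
have /andP[d1 d2] := truncn_itv ba0; set d := Num.truncn _ in d1 d2.
have bab : n.+2%:R * e <= beta * b - beta * a.
  rewrite -mulrBr; move: ab; rewrite -(ler_pM2l beta_gt0) exprS invfM.
  by rewrite mulrCA mulVKf// gt_eqF.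
rewrite -(natr1 n.+1) mulrDl mul1r in bab.
rewrite -natr1 in d2.
have nat_e : 0 <= n.+1%:R * e by rewrite mulr_ge0// ltW.
have zb z' (k : nat) : z' + e <= beta * b - k%:R ->
    (k%:R + z') / beta + (beta ^+ n.+1)^-1 <= b.
  move=> zz; rewrite exprS invfM -/e [beta^-1 * e]mulrC -mulrDl.
  by rewrite ler_pdivrMr// [b * _]mulrC; lra.
(* d + 1 is the first integer above beta * a. *)
have [bd|db] := leP (d.+1%:R + e) (beta * b).
  exists ((d.+1%:R + 0) / beta); last first.
    apply: full_cylinderS; [by []| |exact: full_cylinder0].
    by rewrite add0r invf_le1// exprn_ege1// ltW.
  split; last by apply: zb; lra.
  by rewrite ler_pdivlMr// mulrC addr0 -natr1; lra.
rewrite -natr1 in db.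
have [|||z [az zb'] zfull] :=
  IH (beta * a - d%:R) (Num.min (beta * b - d%:R) 1).
- by rewrite subr_ge0.
- by rewrite ge_min lexx orbT.
- by rewrite -/e lerBrDr le_min; apply/andP; split; lra.
rewrite -/e le_min in zb'; case/andP: zb' => zb1 zb2.
exists ((d%:R + z) / beta); last by apply: full_cylinderS => //; lra.
by split; [rewrite ler_pdivlMr// mulrC; lra|exact: zb].
Qed.

(** In a full cylinder starting at z the map T^n has the fixed point
    w = B z / (B - 1), with B = beta^n, and T^n x - x = (B - 1) (x - w). Staying
    below 1/2 places w in the left half of the cylinder, which leaves room for a
    window to the right of w. *)
Lemma exists_recurrent_window n a b rho : (0 < n)%N -> 0 <= a -> b <= 2^-1 ->
  n.+1%:R / beta ^+ n <= b - a -> 0 <= rho -> beta ^+ n * rho < 2^-1 ->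
  exists2 w, a <= w /\ w + rho <= b &
    forall x, w <= x <= w + rho -> `|iter n T x - x| <= beta ^+ n * rho.
Proof.
move=> n0 a0 b2 ab rho0 rho2.
have b1 : b <= 1 by lra.
have [z [az zb] zfull] := exists_full_cylinder a0 b1 ab.
set B := beta ^+ n in ab rho2 zb zfull *.
have B0 : 0 < B by exact: betaX_gt0.
have B1 : 1 < B by rewrite exprn_egt1// -lt0n.
pose w := B * z / (B - 1).
have Bn1 : B - 1 != 0 by rewrite gt_eqF// subr_gt0.
have wz : B * (w - z) = w by rewrite /w; field.
have zw : z <= w.
  by rewrite /w ler_pdivlMr ?subr_gt0//; nra.
have Bi : B * B^-1 = 1 by rewrite mulfV ?gt_eqF.
have zB : B * z + 1 <= B * 2^-1.
  have -> : B * z + 1 = B * (z + B^-1) by rewrite mulrDr Bi.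
  by rewrite ler_pM2l//; exact: le_trans zb b2.
have w2 : w <= 2^-1.
  by rewrite /w ler_pdivrMr ?subr_gt0//; nra.
have wrho : w + rho < z + B^-1.
  by rewrite -(ltr_pM2l B0) !mulrDr Bi; nra.
exists w; first by split; [exact: le_trans zw|apply: ltW; exact: lt_le_trans zb].
move=> x /andP[wx xw]; rewrite zfull; last first.
  by apply/andP; split; [exact: le_trans wx|exact: le_lt_trans wrho].
have -> : B * (x - z) - x = (B - 1) * (x - w).
  by rewrite -[in RHS]wz; rewrite /w; field.
rewrite ger0_norm; last by rewrite mulr_ge0// subr_ge0// ltW.
by apply: ler_pM; rewrite ?subr_ge0 ?(ltW B1)//; lra.
Qed.

End Dynamics.

(** * Content of homogeneous Cantor sets *)

Section Cantor.
Context {R : realType}.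
Variables (p : R) (M : nat -> nat) (A : nat -> set R).
Hypothesis p1 : 1 <= p.
Hypothesis M2 : forall k, (2 <= M k)%N.

(** The number of windows of generation k. *)
Definition cantor_count k : nat := \prod_(i < k) M i.
Local Notation Q := cantor_count.
(** The length of the windows of generation k is tuned so that their number
    times length^(1/p) stays constant; this is the scaling of a set with positive
    content in dimension 1/p. The factor 2 keeps the first window in
    [0, 1/2]. *)
Definition cantor_width k : R := ((2 * (Q k)%:R)^-1) `^ p.
Local Notation rho := cantor_width.

Hypothesis windows : forall k (a b : R), 0 <= a -> b <= 2^-1 ->
  b - a = rho k / (2 * (M k)%:R) ->
  exists2 w, a <= w /\ w + rho k.+1 <= b &
    forall x, w <= x <= w + rho k.+1 -> A k x.

Let M_gt0 k : (0 < M k)%N. Proof. by have := M2 k; lia. Qed.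
Let MR_gt0 k : 0 < (M k)%:R :> R. Proof. by rewrite ltr0n. Qed.
Let p_gt0 : 0 < p. Proof. exact: lt_le_trans p1. Qed.

Lemma cantor_countS k : Q k.+1 = (Q k * M k)%N.
Proof. by rewrite /Q big_ord_recr. Qed.

Lemma cantor_count_ge k : (2 ^ k <= Q k)%N.
Proof.
elim: k => [|k IH]; first by rewrite /Q big_ord0.
by rewrite cantor_countS expnSr leq_mul.
Qed.

Lemma cantor_count_gt0 k : (0 < Q k)%N.
Proof. by apply: leq_trans (cantor_count_ge k); rewrite expn_gt0. Qed.

Let QR_gt0 k : 0 < (Q k)%:R :> R.
Proof. by rewrite ltr0n cantor_count_gt0. Qed.

Lemma cantor_width_ge0 k : 0 <= rho k.
Proof. exact: powR_ge0. Qed.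

Lemma cantor_width0 : rho 0 <= 2^-1.
Proof.
rewrite /rho /Q big_ord0 mulr1.
by apply: ge1r_powR => //; apply/andP; split; lra.
Qed.

(** [W k j] is the left end of the j-th window of generation k. The parent of the
    j-th window has number j %/ M k, and j %% M k is the number of the block of
    the parent in which it lies. Being in the left half of its block separates
    it from the window in the next block. *)
Lemma exists_cantor_tree : exists W : nat -> nat -> R,
  W 0%N 0%N = 0 /\
  forall k j, (j < Q k.+1)%N ->
  let L := rho k / (M k)%:R in let a := W k (j %/ M k)%N in
  [/\ a + (j %% M k)%:R * L <= W k.+1 j,
      W k.+1 j + rho k.+1 <= a + ((j %% M k)%:R + 2^-1) * L &
      forall x, W k.+1 j <= x <= W k.+1 j + rho k.+1 -> A k x].
Proof.
pose P (kai : nat * R * nat) (w : R) :=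
  let: (k, a, i) := kai in let L := rho k / (M k)%:R in
  0 <= a -> a + rho k <= 2^-1 -> (i < M k)%N ->
  [/\ a + i%:R * L <= w, w + rho k.+1 <= a + (i%:R + 2^-1) * L &
      forall x, w <= x <= w + rho k.+1 -> A k x].
have L0 k : 0 <= rho k / (M k)%:R by rewrite divr_ge0 ?cantor_width_ge0.
have ML k : (M k)%:R * (rho k / (M k)%:R) = rho k.
  by rewrite mulrC divfK// gt_eqF.
have last_block k i : (i < M k)%N ->
    (i%:R + 2^-1) * (rho k / (M k)%:R) <= rho k.
  move=> iM; rewrite -[leRHS]ML ler_wpM2r//.
  have : i.+1%:R <= (M k)%:R :> R by rewrite ler_nat.
  by rewrite -natr1; lra.
have /choice[f Pf] kai : exists w, P kai w.
  case: kai => [[k a] i]; have [H|H] := pselect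
    [/\ 0 <= a, a + rho k <= 2^-1 & (i < M k)%N]; last first.
    by exists 0 => ? a0 a2 iM; exfalso; apply: H; split.
  case: H => a0 a2 iM; set L := rho k / (M k)%:R.
  have [|||w [w1 w2] wA] := windows (k := k) (a := a + i%:R * L)
      (b := a + (i%:R + 2^-1) * L).
  - by rewrite addr_ge0//; apply: mulr_ge0 => //; exact: L0.
  - by apply: le_trans a2; rewrite lerD2l; exact: last_block.
  - by rewrite /L; field; rewrite gt_eqF.
  by exists w.
pose W := fix W k j {struct k} : R :=
  if k is k'.+1 then f (k', W k' (j %/ M k')%N, (j %% M k')%N) else 0.
have Qdiv k j : (j < Q k.+1)%N -> (j %/ M k < Q k)%N.
  by rewrite cantor_countS ltn_divLR.
have W_in k j : (j < Q k)%N -> 0 <= W k j /\ W k j + rho k <= 2^-1.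
  elim: k j => [|k IH] j jQ /=; first by rewrite add0r cantor_width0.
  have [a0 a2] := IH _ (Qdiv _ _ jQ).
  have iM : (j %% M k < M k)%N by rewrite ltn_mod.
  have [w1 w2 _] := Pf (k, W k (j %/ M k)%N, (j %% M k)%N) a0 a2 iM.
  split; first by apply: le_trans w1; rewrite addr_ge0// mulr_ge0.
  by apply: (le_trans w2); apply: le_trans a2; rewrite lerD2l; exact: last_block.
exists W; split=> // k j jQ L a; have [a0 a2] := W_in _ _ (Qdiv _ _ jQ).
exact: (Pf (k, a, (j %% M k)%N)) a0 a2 (ltn_pmod _ (M_gt0 k)).
Qed.

(** The Holder bound comes from the gaps between the windows of one generation
    ([sep] in the proof). Gaps between windows with different parents are
    inherited from the parents. For windows d blocks apart in the same parent,
    the gap is at least d rho / (2 M), while the wanted bound is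
    (d / (2 M))^p rho at most, which is smaller because p >= 1. *)
Lemma cantor_content_neq0 :
  hausdorff_content p^-1 [set x | 0 <= x < 1 /\ forall k, A k x] != 0%E.
Proof.
have [W [W00 HW]] := exists_cantor_tree.
have L0 k : 0 <= rho k / (M k)%:R by rewrite divr_ge0 ?cantor_width_ge0.
have ML k : (M k)%:R * (rho k / (M k)%:R) = rho k.
  by rewrite mulrC divfK// gt_eqF.
have nestl k j : (j < Q k.+1)%N -> W k (j %/ M k)%N <= W k.+1 j.
  move=> /HW[w1 _ _]; apply: le_trans w1.
  by rewrite lerDl mulr_ge0.
have nestr k j : (j < Q k.+1)%N ->
    W k.+1 j + rho k.+1 <= W k (j %/ M k)%N + rho k.
  move=> /HW[_ w2 _]; apply: (le_trans w2).
  rewrite lerD2l -[leRHS]ML ler_wpM2r//.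
  have : (j %% M k).+1%:R <= (M k)%:R :> R by rewrite ler_nat ltn_mod.
  by rewrite -natr1; lra.
have sep k j j' : (j < j')%N -> (j' < Q k)%N ->
    ((j'%:R - j%:R + 1) / (8 * (Q k)%:R)) `^ p <= W k j' - (W k j + rho k).
  elim: k j j' => [|k IH] j j' jj' j'Q.
    by move: j'Q; rewrite /Q big_ord0; lia.
  have jQ := ltn_trans jj' j'Q.
  have := leq_div2r (M k) (ltnW jj').
  rewrite leq_eqVlt => /orP[/eqP qq|qq].
    have := divn_eq j (M k); have := divn_eq j' (M k); rewrite -qq.
    have := ltn_pmod j' (M_gt0 k).
    have [w1 _ _] := HW _ _ j'Q; have [_ w2 _] := HW _ _ jQ.
    rewrite -qq in w1; move: w1 w2.
    set i := (j %% M k)%N; set i' := (j' %% M k)%N.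
    set a := W k _; set L := rho k / _ => w1 w2 i'M j'E jE.
    have ii' : (i < i')%N by lia.
    have -> : j'%:R - j%:R = i'%:R - i%:R :> R.
      have /(congr1 (fun n => n%:R : R)) : (j' + i = j + i')%N by lia.
      by rewrite !natrD; lra.
    pose d : R := i'%:R - i%:R.
    have d1 : 1 <= d.
      have : i.+1%:R <= i'%:R :> R by rewrite ler_nat.
      by rewrite /d -natr1; lra.
    have dM : d <= (M k)%:R.
      have : i'%:R <= (M k)%:R :> R by rewrite ler_nat ltnW.
      by rewrite /d; have : 0 <= i%:R :> R by []; lra.
    have d2M : 0 < d / (2 * (M k)%:R).
      by apply: divr_gt0; [lra|exact: mulr_gt0].
    have Qi : 0 <= (2 * (Q k)%:R)^-1 :> R by rewrite invr_ge0 mulr_ge0.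
    apply: (@le_trans _ _ (d / (2 * (M k)%:R) * rho k)).
      apply: (@le_trans _ _ ((d / (2 * (M k)%:R)) `^ p * rho k)).
        rewrite /rho -powRM ?(ltW d2M)//.
        apply: ge0_ler_powR; rewrite ?nnegrE ?(ltW p_gt0)//.
        - by apply: divr_ge0; [rewrite -/d; lra|exact: mulr_ge0].
        - by apply: mulr_ge0; [exact: ltW|].
        rewrite cantor_countS natrM.
        rewrite ler_pdivrMr ?mulr_gt0//.
        rewrite (_ : d / _ / _ * _ = 2 * d); first by rewrite -/d; lra.
        by field; rewrite !gt_eqF.
      rewrite ler_wpM2r ?cantor_width_ge0// ge1r_powR//.
      rewrite d2M /=.
      by rewrite ler_pdivrMr ?mulr_gt0// mul1r; lra.
    have -> : d / (2 * (M k)%:R) * rho k = d / 2 * L.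
      by rewrite /L; field; rewrite gt_eqF.
    have : d / 2 * L <= (d - 2^-1) * L by apply: ler_wpM2r; [exact: L0|lra].
    move=> dL; apply: (le_trans dL).
    have -> : (d - 2^-1) * L = (a + i'%:R * L) - (a + (i%:R + 2^-1) * L).
      by rewrite /d; ring.
    exact: lerB.
  have q'Q : (j' %/ M k < Q k)%N by rewrite ltn_divLR// -cantor_countS.
  apply: le_trans (_ : _ <= W k (j' %/ M k)%N - (W k (j %/ M k)%N + rho k)) _;
    last by apply: lerB; [exact: nestl|exact: nestr].
  apply: le_trans (IH _ _ qq q'Q).
  have jj'R : j%:R <= j'%:R :> R by rewrite ler_nat ltnW.
  have qqR : (j %/ M k)%:R <= (j' %/ M k)%:R :> R by rewrite ler_nat ltnW.
  rewrite ge0_ler_powR ?nnegrE ?(ltW p_gt0) ?divr_ge0 ?mulr_ge0//; [lra|lra|].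
  rewrite ler_pdivrMr ?mulr_gt0// cantor_countS natrM.
  rewrite (_ : _ / _ * _ = ((j' %/ M k)%:R - (j %/ M k)%:R + 1) * (M k)%:R);
    last by field; rewrite !gt_eqF.
  rewrite mulrDl mulrBl mul1r -!natrM.
  have : (j + 1 + j' %/ M k * M k + M k >= j' + 1 + j %/ M k * M k + 1)%N.
    have := divn_eq j (M k); have := divn_eq j' (M k).
    by have := ltn_pmod j' (M_gt0 k); lia.
  by rewrite -(ler_nat R) !natrD; lra.
pose c (u : R) k := Num.truncn ((Q k)%:R * u).
have cu (u : R) k : 0 <= u -> (c u k)%:R <= (Q k)%:R * u < (c u k).+1%:R.
  by move=> u0; apply: truncn_itv; rewrite mulr_ge0.
have cQ (u : R) k : 0 <= u -> u < 1 -> (c u k < Q k)%N.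
  move=> u0 u1; rewrite -(ltr_nat R); have /andP[cu1 _] := cu u k u0.
  by apply: (le_lt_trans cu1); rewrite gtr_pMr.
have cdiv (u : R) k : 0 <= u -> (c u k.+1 %/ M k)%N = c u k.
  move=> u0; have /andP[c1 c2] := cu u k.+1 u0; apply/esym/truncn_def.
  set q := (_ %/ _)%N; move: c1 c2; rewrite cantor_countS natrM.
  set x := _ * u; have -> : x = (Q k)%:R * u * (M k)%:R by rewrite /x; ring.
  have c3 : (q * M k <= c u k.+1)%N by exact: leq_trunc_div.
  have c4 : ((c u k.+1).+1 <= q.+1 * M k)%N by rewrite -ltn_divLR.
  move: c3 c4; rewrite -!(ler_nat R) !natrM => c3 c4 c1 c2.
  rewrite -(ler_pM2r (MR_gt0 k)) (le_trans c3)//=.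
  by rewrite -(ltr_pM2r (MR_gt0 k)) (lt_le_trans c2).
(* c u k is the number of the window of generation k with address u; these
     windows are nested, and g u is their common point. *)
pose g (u : R) := sup [set W k (c u k) | k in [set: nat]].
have Wmono (u : R) : 0 <= u -> u < 1 ->
    {homo (fun k => W k (c u k)) : k m / (k <= m)%N >-> k <= m}.
  move=> u0 u1; apply: homo_leq => // [y x z|k]; first exact: le_trans.
  by rewrite -(cdiv u k)//; apply: nestl; exact: cQ.
have Wmonor (u : R) : 0 <= u -> u < 1 ->
    {homo (fun k => W k (c u k) + rho k) : k m / (k <= m)%N >-> m <= k}.
  move=> u0 u1; apply: homo_leq => // [y x z|k]; first by move=> ? /le_trans; apply.
  by rewrite -(cdiv u k)//; apply: nestr; exact: cQ.
have Wub (u : R) k : 0 <= u -> u < 1 ->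
    ubound [set W k (c u k) | k in [set: nat]] (W k (c u k) + rho k).
  move=> u0 u1 _ [m _ <-]; apply: (@le_trans _ _ (W (maxn k m) (c u (maxn k m)))).
    by apply: Wmono; rewrite ?leq_maxr.
  apply: le_trans (Wmonor u u0 u1 k (maxn k m) (leq_maxl _ _)).
  by rewrite lerDl cantor_width_ge0.
have g_in (u : R) k : 0 <= u -> u < 1 ->
    W k (c u k) <= g u <= W k (c u k) + rho k.
  move=> u0 u1; apply/andP; split.
    by apply: ub_le_sup; [exists (W 0%N (c u 0%N) + rho 0%N); exact: Wub|exists k].
  by apply: ge_sup; [exists (W 0%N (c u 0%N)), 0%N|exact: Wub].
have c0 (u : R) : 0 <= u -> u < 1 -> c u 0%N = 0%N.
  by move=> u0 u1; have := cQ u 0%N u0 u1; rewrite /Q big_ord0; lia.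
apply: (@hcontent_neq0_of_holder _ p 8 _ g) => //.
- move=> u /andP[u0 u1]; split.
    have /andP[] := g_in u 0%N u0 u1; rewrite c0// W00 add0r => -> /= gu.
    by apply: (le_lt_trans gu); apply: (le_lt_trans cantor_width0); lra.
  move=> k; have [_ _] := HW k (c u k.+1) (cQ _ _ u0 u1).
  by apply; exact: g_in.
- move=> u v u0; rewrite le_eqVlt => /orP[/eqP -> v1|uv v1].
    by rewrite subrr mul0r powR0 ?gt_eqF.
  have v0 : 0 <= v by rewrite ltW// (le_lt_trans u0).
  have u1 := lt_trans uv v1.
  (* A generation fine enough to give u and v different windows. *)
  have [k Qk] : exists k, 1 <= (Q k)%:R * (v - u).
    have vu0 : 0 < v - u by rewrite subr_gt0.
    pose k := (Num.truncn (v - u)^-1).+1; exists k.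
    rewrite -ler_pdivrMr// mul1r.
    have vi0 : 0 <= (v - u)^-1 by rewrite invr_ge0 ltW.
    have /andP[_ /ltW lek] := truncn_itv vi0.
    apply: (le_trans lek); rewrite ler_nat.
    by apply: leq_trans (cantor_count_ge k); rewrite ltnW// ltn_expl.
  have /andP[cu1 cu2] := cu u k u0; have /andP[cv1 cv2] := cu v k v0.
  have cc : (c u k < c v k)%N.
    rewrite -ltnS -(ltr_nat R).
    by rewrite -natr1; rewrite mulrBr in Qk; lra.
  have /andP[gu1 gu2] := g_in u k u0 u1; have /andP[gv1 gv2] := g_in v k v0 v1.
  have sepk := sep k _ _ cc (cQ v k v0 v1).
  apply: le_trans (ler_norm _); apply: le_trans (lerB gv1 gu2).
  apply: le_trans sepk.
  have ccR : (c u k)%:R <= (c v k)%:R :> R by rewrite ler_nat ltnW.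
  rewrite ge0_ler_powR ?nnegrE ?(ltW p_gt0) ?divr_ge0 ?mulr_ge0//; [lra|lra|].
  rewrite ler_pdivlMr ?mulr_gt0//.
  rewrite (_ : _ / _ * _ = (Q k)%:R * v - (Q k)%:R * u); last by field.
  by rewrite -natr1 in cv2; lra.
Qed.

End Cantor.

(** * Level sets of the recurrence exponent *)

Section Scales.
Context {R : realType}.

(** Bernoulli's inequality for the square root of b gives a linear lower bound
    for its powers; squaring makes it quadratic, which beats any linear bound. *)
Lemma exists_expr_ge (b c : R) (k : nat) : 1 < b ->
  exists2 n, (k < n)%N & c * n.+1%:R <= b ^+ n.
Proof.
move=> b1; pose q := Num.sqrt b.
have b0 : 0 <= b by lra.
have q1 : 1 < q by rewrite -sqrtr1 ltr_sqrt//; lra.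
pose d := Num.min (q - 1) 1.
have d0 : 0 < d by rewrite lt_min subr_gt0 q1 ltr01.
have dq : d <= q - 1 by rewrite ge_min lexx.
have d1 : d <= 1 by rewrite ge_min lexx orbT.
have qn n : d * n.+1%:R <= q ^+ n.
  elim: n => [|n IH]; first by rewrite mulr1.
  have qn1 : 1 <= q ^+ n by rewrite exprn_ege1// ltW.
  by rewrite -natr1 exprS; nra.
have c0 : 0 <= `|c| / d ^+ 2 by rewrite divr_ge0 ?exprn_ge0// ltW.
have /andP[_ cm] := truncn_itv c0; set m := Num.truncn _ in cm.
exists (maxn k.+1 m); first by rewrite leq_maxl.
set n := maxn _ _.
have mn : m.+1%:R <= n.+1%:R :> R by rewrite ler_nat ltnS leq_maxr.
have cn : `|c| <= d ^+ 2 * n.+1%:R.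
  by rewrite mulrC -ler_pdivrMr ?exprn_gt0//; apply: ltW; exact: lt_le_trans mn.
have -> : b ^+ n = q ^+ n * q ^+ n by rewrite -exprMn -expr2 sqr_sqrtr.
apply: (@le_trans _ _ ((d * n.+1%:R) * (d * n.+1%:R))).
  have -> : d * n.+1%:R * (d * n.+1%:R) = d ^+ 2 * n.+1%:R * n.+1%:R by ring.
  by rewrite ler_wpM2r// (le_trans (ler_norm c)).
by apply: ler_pM => //; rewrite mulr_ge0// ltW.
Qed.

(** One step of the Cantor construction: n is the new order of recurrence and M
    the number of blocks in a window. Here M is about x = rho beta^n / (2(n+1)),
    the largest number of blocks with half-length at least (n+1) beta^(-n). If
    X = beta^(n eps / p), then X >= 8(n+1) / rho for large n, hence
    x >= 4 beta^n / X, and raising to the power -p turns X into the loss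
    beta^(n eps) of the last inequality. *)
Lemma exists_scale (beta r eps : R) (k Q : nat) :
  1 < beta -> 0 < r -> 0 < eps -> eps <= r -> (0 < Q)%N ->
  exists nM : nat * nat, let: (n, M) := nM in
  [/\ (k < n)%N, (2 <= M)%N,
      n.+1%:R / beta ^+ n <= ((2 * Q%:R)^-1) `^ (1 + r) / (2 * M%:R) &
      beta ^+ n * ((2 * (Q * M)%:R)^-1) `^ (1 + r) <=
        (beta ^+ n) `^ (- (r - eps)) / 4].
Proof.
move=> beta1 r0 eps0 epsr Q0; pose p := 1 + r.
have p0 : 0 < p by rewrite /p; lra.
have beta0 : 0 < beta by lra.
set rho := _ `^ (1 + r).
have QR1 : 1 <= Q%:R :> R by rewrite ler1n.
have rho0 : 0 < rho by rewrite powR_gt0// invr_gt0 mulr_gt0//; lra.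
pose b := beta `^ (eps / p).
have b1 : 1 < b.
  have ep0 : 0 < eps / p by rewrite divr_gt0.
  have := gt0_ltr_powR ep0 (x := 1) (y := beta); rewrite powR1 !nnegrE; apply => //.
  exact: ltW.
have [n kn cn] := exists_expr_ge (8 / rho) k b1.
set Y := beta ^+ n; set X := b ^+ n in cn.
have Y0 : 0 < Y by exact: exprn_gt0.
have X0 : 0 < X by apply: exprn_gt0; lra.
have XY : X = Y `^ (eps / p) by rewrite /X /b -powR_exprn// ltW.
have Y1 : 1 <= Y by rewrite exprn_ege1// ltW.
have XleY : X <= Y.
  rewrite XY -[leRHS]powRr1 ?(ltW Y0)//; apply: ler_powR => //.
  by rewrite ler_pdivrMr// mul1r /p; lra.
have n0 : 0 < n.+1%:R :> R by [].
pose x := rho * Y / (2 * n.+1%:R).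
have xY : 4 * Y <= x * X.
  rewrite /x mulrAC ler_pdivlMr ?mulr_gt0//.
  have -> : 4 * Y * (2 * n.+1%:R) = Y * rho * (8 / rho * n.+1%:R).
    by field; rewrite gt_eqF.
  have -> : rho * Y * X = Y * rho * X by ring.
  by rewrite ler_pM2l// mulr_gt0.
have x4 : 4 <= x by rewrite -(ler_pM2r X0); apply: le_trans xY; lra.
have x0 : 0 <= x by lra.
have /andP[M1 M2] := truncn_itv x0; set M := Num.truncn x in M1 M2.
have M2' : (2 <= M)%N.
  by rewrite -ltnS -(ltr_nat R); apply: le_lt_trans M2; lra.
have M0 : 0 < M%:R :> R by rewrite ltr0n; exact: ltnW M2'.
exists (n, M); split => //.
  rewrite -/Y ler_pdivlMr ?mulr_gt0// mulrAC ler_pdivrMr//.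
  have -> : n.+1%:R * (2 * M%:R) = 2 * n.+1%:R * M%:R :> R by ring.
  apply: (@le_trans _ _ (2 * n.+1%:R * x)); first by rewrite ler_pM2l// mulr_gt0.
  by rewrite /x mulrC divfK// gt_eqF// mulr_gt0.
rewrite -/Y.
have xQM : x <= 2 * (Q * M)%:R.
  have MQM : M%:R <= (Q * M)%:R :> R by rewrite ler_nat leq_pmull.
  have : 2 <= M%:R :> R by rewrite ler_nat.
  by rewrite -natr1 in M2; lra.
have xi : (2 * (Q * M)%:R)^-1 <= X / (4 * Y).
  apply: (@le_trans _ _ x^-1); first by rewrite lef_pV2 ?posrE//; lra.
  rewrite ler_pdivlMr ?mulr_gt0// mulrC ler_pdivrMr; last lra.
  by rewrite [X * x]mulrC.
have QM0 : 0 <= (2 * (Q * M)%:R)^-1 :> R by rewrite invr_ge0 mulr_ge0.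
apply: (@le_trans _ _ (Y * (X / (4 * Y)) `^ p)).
  rewrite ler_pM2l// ge0_ler_powR// ?nnegrE//; first exact: ltW.
  by rewrite divr_ge0// ?mulr_ge0// ltW.
have -> : X / (4 * Y) = 4^-1 * (X * Y^-1) by field; rewrite gt_eqF.
have Yi : 0 <= Y^-1 by rewrite invr_ge0 ltW.
rewrite powRM//; last by rewrite mulr_ge0// ltW.
rewrite powRM//; last exact: ltW.
have -> : Y^-1 `^ p = Y `^ (- p).
  by rewrite -powR_inv1 ?(ltW Y0)// -powRrM mulN1r.
rewrite XY -powRrM divfK ?gt_eqF//.
have -> : Y * (4^-1 `^ p * (Y `^ eps * Y `^ (- p))) =
    4^-1 `^ p * (Y `^ 1 * Y `^ eps * Y `^ (- p)).
  by rewrite powRr1 ?(ltW Y0)//; ring.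
rewrite -!powRD; try by rewrite (gt_eqF Y0) implybT.
rewrite [leRHS]mulrC (_ : 1 + eps - p = - (r - eps)); last by rewrite /p; ring.
rewrite ler_wpM2r ?powR_ge0// ge1r_powR//; last by rewrite /p; lra.
by apply/andP; split; lra.
Qed.

End Scales.

Section Recurrence.
Context {R : realType}.
Variable beta : R.
Hypothesis beta1 : 1 < beta.
Local Notation T := (beta_map beta).
Implicit Types (x t s r : R).

Let beta_gt0 : 0 < beta. Proof. exact: lt_trans beta1. Qed.
Let betaX_ge1 n : 1 <= beta ^+ n. Proof. by rewrite exprn_ege1// ltW. Qed.

Lemma beta_map_itv x : 0 <= T x < 1.
Proof.
rewrite /beta_map subr_ge0 floor_le/= ltrBlDr addrC.
by rewrite -[X in _ + X]/(1%:~R) -intrD floorD1_gt.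
Qed.

Lemma iter_beta_map_itv n x : 0 <= x < 1 -> 0 <= iter n T x < 1.
Proof. by case: n => [//|n] _; exact: beta_map_itv. Qed.

Lemma recurrent_at0 n x : 0 <= x < 1 -> recurrent_at beta 0 n x.
Proof.
move=> x01; split=> //; rewrite oppr0 powRr0.
have /andP[? ?] := iter_beta_map_itv n x01; case/andP: x01 => ? ?.
by rewrite ltr_norml; apply/andP; split; lra.
Qed.

Lemma recurrent_at_le t s n x : t <= s ->
  recurrent_at beta s n x -> recurrent_at beta t n x.
Proof.
move=> ts [x01 xs]; split=> //; apply: (lt_le_trans xs).
by apply: ler_powR; rewrite ?lerN2.
Qed.

Lemma recurrence_exponent_ge t x : 0 <= t -> 0 <= x < 1 ->
  infinite_set [set n | recurrent_at beta t n x] ->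
  (t%:E <= recurrence_exponent beta x)%E.
Proof.
move=> t0 x01 xt; apply: ereal_sup_ubound; split; first by rewrite lee_fin.
by apply: sub_infinite_set xt => n [].
Qed.

(** A supremum above t is witnessed above t by a real exponent: +oo never
    qualifies, since it would ask for distances below 0. *)
Lemma recurrent_of_exponent_gt t x : 0 <= x < 1 ->
  (t%:E < recurrence_exponent beta x)%E ->
  infinite_set [set n | recurrent_at beta t n x].
Proof.
move=> x01 /ereal_sup_gt[[u| |] [_ xu] tu] //.
  apply: sub_infinite_set xu => n xn.
  by apply: (recurrent_at_le (ltW tu)); split.
move: xu => /infinite_setN0[n] /=.
by rewrite ltNge normr_ge0.
Qed.

Lemma hcontent_exponent_gt t s : 0 < s -> 1 < (1 + t) * s ->
  hausdorff_content s
    [set x | 0 <= x < 1 /\ (t%:E < recurrence_exponent beta x)%E] = 0%E.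
Proof.
move=> s0 ts; apply/eqP; rewrite eq_le hcontent_ge0 andbT.
rewrite -(hcontent_recurrent beta1 s0 ts); apply: hcontent_le => x [x01 xt].
by split=> //; exact: recurrent_of_exponent_gt.
Qed.

Lemma hcontent_unit_itv s : 1 < s ->
  hausdorff_content s [set x : R | 0 <= x < 1] = 0%E.
Proof.
move=> s1; apply/eqP; rewrite eq_le hcontent_ge0 andbT.
rewrite -(@hcontent_recurrent _ _ beta1 0 s); [|lra|lra].
apply: hcontent_le => x x01; split=> //.
by apply/infinite_nat_unbounded => m; exists m => //; exact: recurrent_at0.
Qed.

(** The Cantor set uses losses eps k = r / (k+2), which tend to 0, so each t < r
    is eventually below r - eps k. At r = 0 the windows of the construction would
    be too wide for their cylinders; there the set is all of [0, 1) and the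
    identity map does. *)
Lemma hcontent_exponent_ge r : 0 <= r ->
  hausdorff_content (1 + r)^-1
    [set x | 0 <= x < 1 /\ (r%:E <= recurrence_exponent beta x)%E] != 0%E.
Proof.
rewrite le_eqVlt => /orP[/eqP <-|r0].
  rewrite addr0; apply: (@hcontent_neq0_of_holder _ 1 1 _ id) => //.
    move=> u u01; split=> //; apply: recurrence_exponent_ge => //.
    by apply/infinite_nat_unbounded => m; exists m => //; exact: recurrent_at0.
  by move=> u v u0 uv v1; rewrite divr1 powRr1 ?subr_ge0// ler_norm.
pose eps k := r / k.+2%:R.
have eps0 k : 0 < eps k by rewrite divr_gt0.
have epsr k : eps k <= r.
  by rewrite /eps ler_pdivrMr// ler_peMr ?ltW// ltr1n.
have /choice[f Hf] : forall kQ : nat * nat, exists nM : nat * nat,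
    (0 < kQ.2)%N -> let: (n, M) := nM in
    [/\ (kQ.1 < n)%N, (2 <= M)%N,
      n.+1%:R / beta ^+ n <= ((2 * kQ.2%:R)^-1) `^ (1 + r) / (2 * M%:R) &
      beta ^+ n * ((2 * (kQ.2 * M)%:R)^-1) `^ (1 + r) <=
        (beta ^+ n) `^ (- (r - eps kQ.1)) / 4].
  move=> [k Q]; have [->|Q0] := posnP Q; first by exists (0%N, 0%N).
  have [nM HnM] := exists_scale k beta1 r0 (eps0 k) (epsr k) Q0.
  by exists nM.
(* The step at generation k depends on the number of windows built so far, so
     this number, q, is the object defined by recursion. *)
pose q := fix q k : nat := if k is k'.+1 then (q k' * (f (k', q k')).2)%N else 1%N.
pose M k := (f (k, q k)).2; pose N k := (f (k, q k)).1.
have q0 k : (0 < q k)%N.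
  elim: k => //= k IH; have := Hf (k, q k) IH.
  by case: (f _) => n m [_ m2 _ _] /=; rewrite muln_gt0 IH; lia.
have HMN k : [/\ (k < N k)%N, (2 <= M k)%N,
    (N k).+1%:R / beta ^+ (N k) <= ((2 * (q k)%:R)^-1) `^ (1 + r) / (2 * (M k)%:R) &
    beta ^+ (N k) * ((2 * (q k.+1)%:R)^-1) `^ (1 + r) <=
        (beta ^+ (N k)) `^ (- (r - eps k)) / 4].
  by have := Hf (k, q k) (q0 k); rewrite /N /M /=; case: (f _).
have qE k : cantor_count M k = q k.
  elim: k => [|k IH]; first by rewrite /cantor_count big_ord0.
  by rewrite cantor_countS IH.
have M2 k : (2 <= M k)%N by have [] := HMN k.
pose A k := [set x | `|iter (N k) T x - x| < (beta ^+ (N k)) `^ (- (r - eps k))].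
have p1 : 1 <= 1 + r by lra.
have windows k (a b : R) : 0 <= a -> b <= 2^-1 ->
    b - a = cantor_width (1 + r) M k / (2 * (M k)%:R) ->
    exists2 w, a <= w /\ w + cantor_width (1 + r) M k.+1 <= b &
      forall x, w <= x <= w + cantor_width (1 + r) M k.+1 -> A k x.
  move=> a0 b2 ab; have [kN _ Nab Nrho] := HMN k.
  set rho := cantor_width _ _ k.+1.
  have rhoE : rho = ((2 * (q k.+1)%:R)^-1) `^ (1 + r) by rewrite /rho /cantor_width qE.
  set Y := beta ^+ N k in Nab Nrho *.
  have Y0 : 0 < Y by rewrite exprn_gt0.
  have Yr1 : Y `^ (- (r - eps k)) <= 1.
    by rewrite -(powRr0 Y); apply: ler_powR; rewrite ?betaX_ge1// oppr_le0 subr_ge0.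
  have Yr0 : 0 < Y `^ (- (r - eps k)) by exact: powR_gt0.
  rewrite -rhoE in Nrho.
  have [||||w [aw wb] wx] := exists_recurrent_window beta1 (n := N k) (rho := rho) _ a0 b2.
  - exact: leq_ltn_trans kN.
  - by rewrite ab /cantor_width qE.
  - exact: cantor_width_ge0.
  - by rewrite -/Y; lra.
  exists w => // x /wx xw; rewrite /A /= -/Y; apply: (le_lt_trans xw).
  by rewrite -/Y; lra.
have := cantor_content_neq0 p1 M2 windows; apply: contra => /eqP E0.
rewrite eq_le hcontent_ge0 andbT -E0; apply: hcontent_le => x [x01 xA]; split=> //.
have rec t : 0 <= t -> t < r -> (t%:E <= recurrence_exponent beta x)%E.
  move=> t0 tr; apply: recurrence_exponent_ge => //.
  apply/infinite_nat_unbounded => m.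
  have rt0 : 0 < r - t by rewrite subr_gt0.
  have rrt : 0 <= r / (r - t) by rewrite divr_ge0 ?ltW.
  have /andP[_ rk] := truncn_itv rrt.
  pose k := maxn m (Num.truncn (r / (r - t))).
  have [kN _ _ _] := HMN k.
  exists (N k); first by apply: ltnW; apply: leq_ltn_trans kN; rewrite leq_maxl.
  apply: (@recurrent_at_le t (r - eps k)); last by split=> //; exact: xA.
  rewrite lerBrDr -lerBrDl /eps ler_pdivrMr// mulrC -ler_pdivrMr//.
  apply: (le_trans (ltW rk)); rewrite ler_nat.
  by rewrite (leq_trans _ (leqnSn _))// ltnS leq_maxr.
rewrite leNgt; apply/negP => xr.
have := rec 0 (lexx _) r0; move: xr rec.
case: (recurrence_exponent beta x) => [u| |] //=; rewrite lte_fin lee_fin => ur rec u0.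
have := rec ((u + r) / 2); rewrite lee_fin => H.
have : (u + r) / 2 <= u by apply: H; lra.
lra.
Qed.

(** At the critical dimension 1/(1+r) the points of exponent above r are
    negligible, so they can be removed from {exponent >= r}. *)
Lemma hcontent_exponent_eq r : 0 <= r ->
  hausdorff_content (1 + r)^-1
    [set x | 0 <= x < 1 /\ recurrence_exponent beta x = r%:E] != 0%E.
Proof.
move=> r0; apply: contra (hcontent_exponent_ge r0) => /eqP E0.
have r1 : 0 < 1 + r by lra.
pose F m := [set x | 0 <= x < 1 /\
  ((r + m.+1%:R^-1)%:E < recurrence_exponent beta x)%E].
have F0 : hausdorff_content (1 + r)^-1 (\bigcup_m F m) = 0%E.
  apply: hcontent0_bigcup => m; apply: hcontent_exponent_gt; first by rewrite invr_gt0.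
  by rewrite ltr_pdivlMr// mul1r addrA ltrDl invr_gt0.
rewrite eq_le hcontent_ge0 andbT -(hcontent_setU0 E0 F0).
apply: hcontent_le => x [x01]; rewrite le_eqVlt => /orP[/eqP xr|rx].
  by left; split.
right; move: rx; rewrite /F; case E: (recurrence_exponent beta x) => [u| |]//.
  rewrite lte_fin => ru; have ur : 0 <= (u - r)^-1 by rewrite invr_ge0 subr_ge0 ltW.
  have /andP[_ um] := truncn_itv ur; exists (Num.truncn (u - r)^-1) => //=.
  split=> //; rewrite E lte_fin -ltrBrDl invf_plt ?posrE ?subr_gt0//.
by move=> _; exists 0%N => //=; rewrite E ltry.
Qed.

End Recurrence.

Unset Implicit Arguments.

Theorem corollary1p3 (R : realType) (beta : R) (hbeta : 1 < beta)
    (r : \bar R) (hr : (0 <= r)%E) :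
  hausdorff_dim [set x : R | 0 <= x < 1 /\ recurrence_exponent beta x = r]
    = ((1 + r)^-1)%E.
Proof.
case: r hr => [r| |] //.
  rewrite lee_fin => r0; have r1 : 0 < 1 + r by lra.
  rewrite -EFinD inver gt_eqF//; apply/eqP; rewrite eq_le; apply/andP; split.
    apply: hausdorff_dim_le => [|s rs]; first by rewrite invr_ge0 ltW.
    have s0 : 0 < s by apply: lt_trans rs; rewrite invr_gt0.
    have sr : 1 < (1 + r) * s by rewrite mulrC -ltr_pdivrMr// mul1r.
    have [r00|rn0] := eqVneq r 0.
      rewrite r00 in sr *; apply/eqP; rewrite eq_le hcontent_ge0 andbT.
      by rewrite -(@hcontent_unit_itv _ _ hbeta s); [apply: hcontent_le => x []|lra].
    pose t := (r + (s^-1 - 1)) / 2.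
    have sr' : s^-1 < 1 + r by rewrite invf_plt// posrE.
    have ts : s^-1 < 1 + t by rewrite /t; lra.
    apply/eqP; rewrite eq_le hcontent_ge0 andbT.
    rewrite -(@hcontent_exponent_gt _ _ hbeta t s s0).
      by apply: hcontent_le => x [x01 xr]; split=> //; rewrite xr lte_fin /t; lra.
    by rewrite -ltr_pdivrMr// mul1r.
  exact/hausdorff_dim_ge/hcontent_exponent_eq.
move=> _; rewrite addey// invey; apply/eqP.
rewrite eq_le hausdorff_dim_ge0 andbT; apply: hausdorff_dim_le => // s s0.
apply/eqP; rewrite eq_le hcontent_ge0 andbT.
rewrite -(@hcontent_exponent_gt _ _ hbeta s^-1 s s0).
  by apply: hcontent_le => x [x01 xr]; split=> //; rewrite xr ltry.
by rewrite mulrDl mul1r mulVf ?gt_eqF// ltrDr.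
Qed.
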